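(* Let $n$ be odd, let $\pi=\{p_1,\dots,p_n\}$, let $\lambda$ be an odd multiple of $1/4$, put $k=n/2-2\lambda-1$ (assumed $\ge0$), and let $\eta\subset\pi$ be a subset with $|\eta|\equiv(n-4\lambda)/2\pmod 2$. Then in the algebra $A_n=\mathbb Q[\alpha,\delta_1,\dots,\delta_n]/\langle\delta_i^2-\delta_j^2\rangle_{i,j}$ one has $$k!\,w^k_{n,\eta}=\prod_{\substack{j=-k+1\\ j\equiv -k+1 \bmod 2}}^{k-1}\bigl(B_\eta+j\,\delta_1\bigr),$$ where $B_\eta=\alpha+\frac12\sum_{p\in\eta}\delta_p-\frac12\sum_{p\notin\eta}\delta_p$ (with $\delta_{p_i}=\delta_i$) and $w^k_{n,\eta}$ is defined in the context.
   Context: Grade $A_n$ with $\alpha,\delta_i$ of degree 1 (cohomological degree 2). The element $w^k_{n,\eta}\in A_n$ is the degree-$k$ Chern class associated by the universal formulae to the formal Chern character $$r=(n/2-2\lambda-2)\cosh(\delta_1)+\frac{\sinh(\delta_1)}{\delta_1}B_\eta=(k-1)\cosh(\delta_1)+\frac{\sinh(\delta_1)}{\delta_1}B_\eta$$ in the graded completion of $A_n$. That is, $w^k_{n,\eta}=\mathfrak c_k(r)$, where $\mathfrak c_k$ is the universal polynomial in the homogeneous components with $\mathfrak c_k(\operatorname{ch}(V))=c_k(V)$ for any virtual bundle $V$; explicitly, if $r=\sum_j r_j$ with $r_j$ homogeneous of degree $j$, then $\sum_k\mathfrak c_k(r)t^k=\exp\bigl(\sum_{j\ge1}(-1)^{j-1}(j-1)!\,r_jt^j\bigr)$.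 *)

(* Defs.v *)
From HB Require Import structures.
From mathcomp Require Import all_boot all_order all_algebra.
From mathcomp Require Import ring_quotient generic_quotient.
From mathcomp.multinomials Require Import mpoly.
From mathcomp.classical Require Import boolp.

Set Implicit Arguments.
Unset Strict Implicit.
Unset Printing Implicit Defensive.

Import Order.TTheory GRing.Theory Num.Theory.

Local Open Scope ring_scope.
Local Open Scope quotient_scope.

(* Q[alpha, delta_1, ..., delta_n] is {mpoly rat[n.+1]}: the variable of index
   ord0 is alpha, and the one of index lift ord0 i is delta_(i+1). *)
Definition Xalpha n : {mpoly rat[n.+1]} := 'X_ord0.
Definition Xdelta n (i : 'I_n) : {mpoly rat[n.+1]} := 'X_(lift ord0 i).

Definition delta_ideal n : {mpoly rat[n.+1]} -> bool :=
  fun p => `[< exists c : 'I_n -> 'I_n -> {mpoly rat[n.+1]},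
    p = \sum_i \sum_j c i j * (Xdelta i ^+ 2 - Xdelta j ^+ 2) >].

Lemma delta_ideal_closed n : idealr_closed (@delta_ideal n : {pred _}).
Proof.
split.
- apply/asboolP; exists (fun _ _ => 0).
  by rewrite big1 // => i _; rewrite big1 // => j _; rewrite mul0r.
- apply/negP => /asboolP [c /(congr1 (meval (fun=> 0)))] /eqP.
  rewrite meval1 raddf_sum /= big1 ?oner_eq0 // => i _.
  rewrite raddf_sum /= big1 // => j _.
  by rewrite mevalM mevalB !rmorphXn /= !mevalXU expr0n subrr mulr0.
- move=> a u v /asboolP [c ->] /asboolP [d ->]; apply/asboolP.
  exists (fun i j => a * c i j + d i j).
  rewrite mulr_sumr -big_split /=; apply: eq_bigr => i _.
  rewrite mulr_sumr -big_split /=; apply: eq_bigr => j _.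
  by rewrite mulrDl mulrA.
Qed.

HB.instance Definition _ n :=
  isIdealr.Build {mpoly rat[n.+1]} (@delta_ideal n) (@delta_ideal_closed n).

Definition delta_idealr n : idealr {mpoly rat[n.+1]} :=
  Idealr.clone {mpoly rat[n.+1]} (@delta_ideal n) _.

Definition A n : Type := {ideal_quot (delta_idealr n)}.

HB.instance Definition _ n := GRing.ComNzRing.on (A n).

Definition toA n (p : {mpoly rat[n.+1]}) : A n :=
  \pi_{ideal_quot (delta_idealr n)} p.

Lemma toA_is_zmod_morphism n : zmod_morphism (@toA n).
Proof. by move=> p q; rewrite /toA; exact: raddfB. Qed.

Lemma toA_is_monoid_morphism n : monoid_morphism (@toA n).
Proof. by split; [exact: rmorph1|exact: rmorphM]. Qed.

HB.instance Definition _ n :=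
  GRing.isZmodMorphism.Build _ _ (@toA n) (@toA_is_zmod_morphism n).
HB.instance Definition _ n :=
  GRing.isMonoidMorphism.Build _ _ (@toA n) (@toA_is_monoid_morphism n).

Definition scaleA n (c : rat) (a : A n) : A n := toA c%:MP * a.

Lemma scaleA_A n c d (a : A n) : scaleA c (scaleA d a) = scaleA (c * d) a.
Proof. by rewrite /scaleA mpolyCM rmorphM /= mulrA. Qed.

Lemma scale1A n : left_id 1 (@scaleA n).
Proof. by move=> a; rewrite /scaleA mpolyC1 rmorph1 mul1r. Qed.

Lemma scaleADr n : right_distributive (@scaleA n) +%R.
Proof. by move=> c a b; rewrite /scaleA mulrDr. Qed.

Lemma scaleADl n (a : A n) : {morph (@scaleA n)^~ a : c d / c + d}.
Proof. by move=> c d; rewrite /scaleA mpolyCD rmorphD /= mulrDl. Qed.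

HB.instance Definition _ n := GRing.Zmodule_isLmodule.Build rat (A n)
  (@scaleA_A n) (@scale1A n) (@scaleADr n) (@scaleADl n).

Lemma scaleAAl n (c : rat) (a b : A n) : c *: (a * b) = c *: a * b.
Proof. exact: mulrA. Qed.

HB.instance Definition _ n :=
  GRing.Lmodule_isLalgebra.Build rat (A n) (@scaleAAl n).
HB.instance Definition _ n := GRing.Lalgebra_isComAlgebra.Build rat (A n).

Definition alpha n : A n := toA (Xalpha n).
Definition delta n (i : 'I_n) : A n := toA (Xdelta i).

Lemma toA_eqP n p q :
  toA p = toA q <-> exists c : 'I_n -> 'I_n -> {mpoly rat[n.+1]},
    p - q = \sum_i \sum_j c i j * (Xdelta i ^+ 2 - Xdelta j ^+ 2).
Proof.
have h : (p - q \in (@delta_ideal n : {pred _})) = (toA p == toA q).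
  exact: Quotient.idealrBE.
split=> [/eqP|]; first by rewrite -h => /asboolP.
by move=> hc; apply/eqP; rewrite -h; apply/asboolP.
Qed.

Lemma toAZ n (c : rat) (p : {mpoly rat[n.+1]}) : toA (c *: p) = c *: toA p.
Proof. by rewrite -mul_mpolyC rmorphM. Qed.

Lemma toA_surj n (a : A n) : exists p, a = toA p.
Proof. by exists (repr a); rewrite /toA reprK. Qed.

Definition homogA n (d : nat) (a : A n) : Prop :=
  exists2 p : {mpoly rat[n.+1]}, p \is d.-homog & a = toA p.

(* An element of the graded completion of a graded algebra R is given by its
   sequence of homogeneous components, the j-th one in degree j. *)
Section Series.
Variable R : comAlgType rat.
Implicit Types (x : R) (r s : nat -> R).

Definition series_mul r s : nat -> R :=
  fun j => \sum_(i < j.+1) r i * s (j - i)%N.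

Definition in_degree (d : nat) x : nat -> R :=
  fun j => if j == d then x else 0.

(* cosh x and (sinh x) / x for x of degree 1 *)
Definition cosh_series x : nat -> R :=
  fun j => if odd j then 0 else (j`!%:R : rat)^-1 *: x ^+ j.

Definition sinhc_series x : nat -> R :=
  fun j => if odd j then 0 else (j.+1`!%:R : rat)^-1 *: x ^+ j.

(* The coefficient of t^k in exp (\sum_(j >= 1) (-1)^(j-1) (j-1)! r_j t^j): the
   exponent has no constant term, so only its terms with j <= k, and its l-th
   powers with l <= k, contribute to it. *)
Definition chern_class r (k : nat) : R :=
  let u : {poly R} :=
    \sum_(1 <= j < k.+1) ((-1) ^+ j.-1 * (j.-1)`!%:R) *: (r j *: 'X^j) in
  \sum_(l < k.+1) (l`!%:R : rat)^-1 *: (u ^+ l)`_k.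

End Series.

Section Classes.
Variable n : nat.
Implicit Type eta : {set 'I_n}.

Definition B eta : A n :=
  alpha n + 2^-1 *: \sum_(p in eta) delta p
          - 2^-1 *: \sum_(p | p \notin eta) delta p.

(* p1 is the index of the distinguished variable delta_1. *)
Definition chern_char (p1 : 'I_n) (k : nat) eta : nat -> A n :=
  fun j => (k%:R - 1 : rat) *: cosh_series (delta p1) j
           + series_mul (sinhc_series (delta p1)) (in_degree 1 (B eta)) j.

Definition w (p1 : 'I_n) (k : nat) eta : A n :=
  chern_class (chern_char p1 k eta) k.

Lemma delta_homog (p : 'I_n) : homogA 1 (delta p).
Proof. by exists (Xdelta p) => //; rewrite dhomogX /= mdeg1. Qed.

Lemma homogAD d (a b : A n) : homogA d a -> homogA d b -> homogA d (a + b).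
Proof.
move=> [p hp ->] [q hq ->]; exists (p + q); last by rewrite rmorphD.
exact: rpredD.
Qed.

Lemma homogAZ d c (a : A n) : homogA d a -> homogA d (c *: a).
Proof.
move=> [p hp ->]; exists (c *: p); last by rewrite toAZ.
exact: rpredZ.
Qed.

Lemma homogA0 d : homogA d (0 : A n).
Proof. by exists 0; rewrite ?rmorph0 ?rpred0. Qed.

Lemma homogAM d e (a b : A n) :
  homogA d a -> homogA e b -> homogA (d + e) (a * b).
Proof.
move=> [p hp ->] [q hq ->]; exists (p * q); last by rewrite rmorphM.
exact: dhomogM.
Qed.

Lemma homogAX d (a : A n) j : homogA d a -> homogA (d * j) (a ^+ j).
Proof.
move=> [p hp ->]; exists (p ^+ j); last by rewrite rmorphXn.
exact: dhomogMn.
Qed.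

Lemma homogA_sum (I : Type) (s : seq I) (P : pred I) (F : I -> A n) d :
  (forall i, P i -> homogA d (F i)) -> homogA d (\sum_(i <- s | P i) F i).
Proof.
by move=> h; elim/big_ind: _ => // [|a b]; [exact: homogA0|exact: homogAD].
Qed.

Lemma B_homog eta : homogA 1 (B eta).
Proof.
rewrite /B -scaleNr; apply: homogAD; first apply: homogAD.
- by exists (Xalpha n) => //; rewrite dhomogX /= mdeg1.
- by apply: homogAZ; apply: homogA_sum => p _; apply: delta_homog.
- by apply: homogAZ; apply: homogA_sum => p _; apply: delta_homog.
Qed.

Lemma chern_char_homog p1 k eta j : homogA j (chern_char p1 k eta j).
Proof.
have hX m : homogA m (delta p1 ^+ m).
  by rewrite -[m in homogA m]mul1n; apply/homogAX/delta_homog.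
apply: homogAD.
  apply: homogAZ; rewrite /cosh_series.
  by case: ifP => _; [exact: homogA0|exact: homogAZ].
apply: homogA_sum => i _; rewrite -[j in homogA j](subnKC (ltn_ord i : i <= j)%N).
apply: homogAM.
  by rewrite /sinhc_series; case: ifP => _; [exact: homogA0|exact: homogAZ].
by rewrite /in_degree; case: eqP => [->|_]; [exact: B_homog|exact: homogA0].
Qed.

End Classes.

Definition zrange (a b : int) : seq int :=
  if a <= b then [seq a + i%:Z | i <- iota 0 `|b - a|.+1] else [::].

Lemma mem_zrange a b x : (x \in zrange a b) = (a <= x <= b).
Proof.
rewrite /zrange; case: ifPn => [ab|nab]; last first.
  by apply/esym/negbTE; apply: contraNN nab => /andP[]; exact: le_trans.
have hba : (`|b - a|%N%:Z = b - a) by rewrite abszE ger0_norm // subr_ge0.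
apply/mapP/andP => [[i]|[ax xb]].
  rewrite mem_iota /= add0n ltnS => hi ->; rewrite lerDl; split=> //.
  by rewrite addrC -lerBrDr -hba lez_nat.
have hxa : (`|x - a|%N%:Z = x - a) by rewrite abszE ger0_norm // subr_ge0.
exists `|x - a|%N; last by rewrite hxa addrC subrK.
by rewrite mem_iota /= add0n ltnS -lez_nat hxa hba lerD2r.
Qed.

Lemma zrange_uniq a b : uniq (zrange a b).
Proof.
rewrite /zrange; case: ifP => // _; rewrite map_inj_uniq ?iota_uniq //.
by move=> i j /addrI [].
Qed.

(* Main.v *)
(* Put d = delta_1, b = B_eta and y = k - 1. The total Chern class c(t) is
   formally (1 - d^2 t^2)^(y/2) ((1 + d t) / (1 - d t))^(b/2d), so
   (1 - d^2 t^2) c' = (b - y d^2 t) c, i.e. a_m = m! c_m satisfies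
     a_{m+1} = b a_m - m (y - m + 1) d^2 a_{m-1}.
   Passing from (y - 1, b - d) to (y, b) multiplies c(t) by 1 + d t. For
   y = k - 1 the last coefficient of the recurrence for a_k at (y - 1, b - d)
   vanishes, whence a_k(y, b) = (b + (k - 1) d) a_{k-1}(y - 1, b - d), and the
   product formula follows by induction on k. This holds in every commutative
   Q-algebra. *)

Require Import Defs.
From mathcomp Require Import all_boot all_order all_algebra.
From mathcomp Require Import ring zify.

Import GRing.Theory.
Local Open Scope ring_scope.

(* For y = m - 1 this is the determinant of the Sylvester-Kac tridiagonal matrix. *)
Fixpoint kac (R : comNzRingType) (y b d : R) (m : nat) : R :=
  if m is m1.+1 then
    b * kac R y b d m1
    - (if m1 is m2.+1 then m1%:R * (y - m2%:R) * d ^+ 2 * kac R y b d m2 else 0)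
  else 1.
Arguments kac {R} y b d m : simpl never.

Lemma kac0 (R : comNzRingType) (y b d : R) : kac y b d 0 = 1.
Proof. by []. Qed.

Lemma kac1 (R : comNzRingType) (y b d : R) : kac y b d 1 = b.
Proof. by rewrite /kac mulr1 subr0. Qed.

Lemma kacSS (R : comNzRingType) (y b d : R) m :
  kac y b d m.+2 =
    b * kac y b d m.+1 - m.+1%:R * (y - m%:R) * d ^+ 2 * kac y b d m.
Proof. by []. Qed.

(** Coefficient form of multiplying the exponential generating series by 1 + d t. Since the
    recurrence has order two, the induction carries two consecutive indices. *)
Lemma kac_shift (R : comNzRingType) (y b d : R) m :
  kac y b d m.+1 =
    kac (y - 1) (b - d) d m.+1 + m.+1%:R * d * kac (y - 1) (b - d) d m.
Proof.
suff: kac y b d m.+1 =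
    kac (y - 1) (b - d) d m.+1 + m.+1%:R * d * kac (y - 1) (b - d) d m /\
  kac y b d m.+2 =
    kac (y - 1) (b - d) d m.+2 + m.+2%:R * d * kac (y - 1) (b - d) d m.+1.
  by case.
elim: m => [|m [IH1 IH2]].
  by rewrite !kacSS !kac1 !kac0; split; ring.
split=> //; rewrite kacSS IH2 IH1 !kacSS -!natr1; ring.
Qed.

Lemma kac_prod (R : comNzRingType) (b d : R) k :
  kac (k%:R - 1) b d k = \prod_(i < k) (b + (i%:R *+ 2 - k%:R + 1) * d).
Proof.
elim: k b => [|k IHk] b; first by rewrite kac0 big_ord0.
have step : kac (k.+1%:R - 1) b d k.+1
    = (b + k%:R * d) * kac (k%:R - 1) (b - d) d k.
  have -> : k.+1%:R - 1 = k%:R :> R by rewrite -natr1 addrK.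
  rewrite kac_shift; case: k {IHk} => [|k].
    by rewrite kac0 !kac1; ring.
  (* With [k] now replaced by k + 1, the last coefficient contains (k + 1) - 1 - k = 0. *)
  rewrite kacSS -!natr1; ring.
rewrite step IHk big_ord_recr /= mulrC -!natr1; congr (_ * _); last by ring.
by apply: eq_bigr => i _; ring.
Qed.

Lemma factV_mulS (R : comAlgType rat) l :
  (((l.+1)`!%:R : rat)^-1)%:A *+ l.+1 = ((l`!%:R : rat)^-1)%:A :> R.
Proof.
rewrite scalerMnl -mulr_natr factS natrM invfM mulrAC mulVf ?mul1r //.
by rewrite Num.Theory.pnatr_eq0.
Qed.

(** Newton's identities, read off from E' = u' E for E = exp u; the truncation spoils this equation
    only from degree M on. *)
Lemma exp_trunc_coef (R : comAlgType rat) (u : {poly R}) (M m : nat) :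
  let E := \sum_(l < M.+1) (((l`!%:R : rat)^-1)%:A : R) *: u ^+ l in
  u`_0 = 0 -> (m < M)%N ->
  E`_m.+1 *+ m.+1 = \sum_(i < m.+1) (u`_i.+1 *+ i.+1) * E`_(m - i).
Proof.
move=> E u0 mM.
have [v def_u] : exists v, u = v * 'X.
  have /factor_theorem[v ->] : root u 0 by rewrite /root horner_coef0 u0.
  by exists v; rewrite subr0.
(* E' and u' E differ by the top term only, which is divisible by X^M since u_0 = 0. *)
have dE : E^`() + u^`() * ((((M`!%:R : rat)^-1)%:A : R) *: u ^+ M) = u^`() * E.
  rewrite /E raddf_sum /= big_ord_recl /= expr0 derivZ derivC scaler0 add0r.
  rewrite big_ord_recr /= mulrDr; congr (_ + _).
  rewrite mulr_sumr; apply: eq_bigr => l _; rewrite /bump /= add1n.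
  rewrite derivZ deriv_exp /= -scalerMnr scalerMnl factV_mulS.
  by rewrite scalerAr.
have := congr1 (fun p : {poly R} => p`_m) dE.
rewrite coefD coef_deriv -scalerAr coefZ def_u exprMn mulrA coefMXn mM mulr0 addr0.
move=> ->; rewrite -def_u coefM; apply: eq_bigr => i _; by rewrite coef_deriv.
Qed.

(** The hypothesis gives the positive-degree part of y cosh d + (sinh d / d) b, with denominators
    cleared. *)
Lemma chern_class_kac (R : comAlgType rat) (y b d : R) (r : nat -> R) k :
  (forall j, r j.+1 *+ j.+1`! = (if odd j then y * d else b) * d ^+ j) ->
  k`!%:R * chern_class r k = kac y b d k.
Proof.
move=> r_def.
pose u : {poly R} :=
  \sum_(1 <= j < k.+1) ((-1) ^+ j.-1 * (j.-1)`!%:R) *: (r j *: 'X^j).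
pose E := \sum_(l < k.+1) (((l`!%:R : rat)^-1)%:A : R) *: u ^+ l.
have u0 : u`_0 = 0.
  rewrite coef_sum big_nat big1 // => j /andP[j0 _].
  by rewrite !coefZ coefXn; case: j j0 => // j _; rewrite !mulr0.
(* Below degree k, u' agrees with (b - y d^2 t) / (1 - d^2 t^2). *)
have uS j : (j < k)%N ->
    u`_j.+1 *+ j.+1 = (if odd j then - (y * d) else b) * d ^+ j.
  move=> jk; rewrite coef_sum (bigD1_seq j.+1) ?iota_uniq ?mem_index_iota //=.
  rewrite big1 => [|i /negPf ij]; last by rewrite !coefZ coefXn eq_sym ij !mulr0.
  rewrite addr0 !coefZ coefXn eqxx mulr1 /= -mulrA -mulrnAr -mulrnAr mulr_natl.
  rewrite -mulrnA -factS r_def -signr_odd.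
  by case: (odd j); rewrite ?expr1 ?expr0 ?mul1r // mulN1r mulNr.
have E0 : E`_0 = 1.
  rewrite coef_sum big_ord_recl big1 ?addr0 => [|i _].
    by rewrite coefZ coef1 mulr1 invr1 scale1r.
  by rewrite coefZ /= exprSr coef0M u0 !mulr0.
have newton m : (m < k)%N ->
  E`_m.+1 *+ m.+1 =
    \sum_(i < m.+1) (if odd i then - (y * d) else b) * d ^+ i * E`_(m - i).
  move=> mk; rewrite exp_trunc_coef //; apply: eq_bigr => i _; rewrite uS //.
  by rewrite (leq_ltn_trans _ mk) // -ltnS.
have rec m : (m.+1 < k)%N -> E`_m.+2 *+ m.+2 =
   b * E`_m.+1 - (y - m%:R) * d ^+ 2 * E`_m.
  move=> mk; rewrite newton // !big_ord_recl /= subn0 subSS subn0.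
  have -> : \sum_(i < m) (if odd (bump 0 (bump 0 i)) then - (y * d) else b) *
      d ^+ bump 0 (bump 0 i) * E`_(m.+1 - bump 0 (bump 0 i))
      = d ^+ 2 * (E`_m *+ m).
    case: m mk => [|m] mk; first by rewrite big_ord0 mulr0n mulr0.
    rewrite newton 1?ltnW 1?ltnW // mulr_sumr; apply: eq_bigr => i _.
    rewrite /bump /= !add1n !subSS /= negbK !exprS expr0 mulr1.
    by case: (odd i); ring.
  rewrite -mulr_natl /bump /=; ring.
have main m : (m <= k)%N -> m`!%:R * E`_m = kac y b d m /\
    ((m < k)%N -> m.+1`!%:R * E`_m.+1 = kac y b d m.+1).
  elim: m => [|m IHm] mk.
    split=> [|k0]; first by rewrite E0 mulr1.
    rewrite kac1 mul1r -[LHS]mulr1n newton // big_ord_recl big_ord0 E0 /=; ring.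
  have [IH1 /(_ mk) IH2] := IHm (ltnW mk); split=> // mk2.
  rewrite kacSS -IH1 -IH2 factS natrM -[LHS]mulrA mulrCA.
  rewrite [_.+2%:R * _]mulr_natl rec //.
  rewrite factS natrM; ring.
have [<- _] := main k (leqnn k); congr (_ * _); rewrite coef_sum.
by apply: eq_bigr => l _; rewrite coefZ -scalerAl mul1r.
Qed.

(** Matches the factors of [kac_prod] with those of the theorem; for k = 0 both lists are empty. *)
Lemma parity_zrange k :
  perm_eq [seq j <- zrange (- k%:Z + 1) (k%:Z - 1) | (j == - k%:Z + 1 %[mod 2])%Z]
          [seq i%:Z *+ 2 - k%:Z + 1 | i <- iota 0 k].
Proof.
apply: uniq_perm; first exact/filter_uniq/zrange_uniq.
  by rewrite map_inj_uniq ?iota_uniq // => i j; lia.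
move=> x; rewrite mem_filter mem_zrange; apply/andP/mapP => [[xk /andP[h1 h2]]|[i]]; last first.
  rewrite mem_iota => hi ->; split; last by lia.
  lia.
(* Solves x = 2 i - k + 1: x + k - 1 is nonnegative by the lower bound and even by the
   congruence. *)
exists (`|(x + k%:Z - 1)%R|%N %/ 2)%N; last by lia.
by rewrite mem_iota; lia.
Qed.

Theorem proposition4p7 (n : nat) (hn : odd n) (lambda : rat)
    (hlambda : exists m : int, lambda = (2 * m + 1)%:~R / 4)
    (k : nat) (hk : k%:R = n%:R / 2 - 2 * lambda - 1 :> rat)
    (eta : {set 'I_n})
    (heta : exists m : int, #|eta|%:R - (n%:R - 4 * lambda) / 2 = 2 * m%:~R :> rat) :
  let p1 : 'I_n := Ordinal (odd_gt0 hn) in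
  k`!%:R * w p1 k eta =
    \prod_(j <- zrange (- k%:Z + 1) (k%:Z - 1) | (j == - k%:Z + 1 %[mod 2])%Z)
      (B eta + j%:~R * delta p1).
Proof.
move=> p1; rewrite /w (chern_class_kac _ (k%:R - 1) (B eta) (delta p1)); last first.
  move=> j; rewrite /chern_char /series_mul /in_degree.
  (* [B eta] sits in degree 1, so only i = j survives in degree j + 1. *)
  have -> : \sum_(i < j.+2)
      sinhc_series (delta p1) i * (if (j.+1 - i)%N == 1%N then B eta else 0) =
      sinhc_series (delta p1) j * B eta.
    rewrite (bigD1 (inord j)) //= inordK // subSnn eqxx big1 ?addr0 // => i ij.
    case: eqP => ji; rewrite ?mulr0 //; case/eqP: ij; apply/val_inj.
    by rewrite /= inordK //; lia.
  have fact_div x : (j.+1`!%:R : rat)^-1 *: x *+ j.+1`! = x :> A n.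
    by rewrite scalerMnl -mulr_natr mulVf ?scale1r //
      Num.Theory.pnatr_eq0 -lt0n fact_gt0.
  rewrite mulrnDl /sinhc_series /cosh_series /=; case: (odd j) => /=.
    rewrite mul0r mul0rn addr0 scalerMnr fact_div exprS scalerBl scaler_nat scale1r.
    rewrite -mulr_natl; ring.
  by rewrite scaler0 mul0rn add0r -mulrnAl fact_div mulrC.
rewrite kac_prod -big_filter (perm_big _ (parity_zrange k)) big_map /=.
rewrite -[k in iota 0 k]subn0 -/(index_iota 0 k) big_mkord; apply: eq_bigr => i _.
by congr (_ + _ * _); rewrite !rmorphD rmorphN.
Qed.
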